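(* Let $k\ge 1$. Let $f, g_1,\ldots,g_k:(-\infty,0)\to\mathbb{R}$ and $s:[0,\infty)\to\mathbb{R}$ be ordinal decreasing functions that are strictly positive at every point of their domains, and let $M:\mathbb{R}\to\mathbb{R}$ be the (well-defined, ordinal decreasing) function given by \[ M(x)=\begin{cases} f(x), & x<0,\\ g_1\bigl(-M(x-g_2(-M(x-\cdots-g_k(-M(x-s(x)))\cdots)))\bigr), & x\ge 0.\end{cases} \] (1) If $k=1$, let $\gamma$ be an ordinal with $\max\{o(f),o(s),o(g_1)\}<\omega^{\omega^\gamma}$. Then $o(M)\le \omega^{\omega^{\gamma+1}(o(s)+1)}$. (2) If $k\ge 2$, let $\gamma$ be an ordinal with $\max\{o(f),o(s),o(g_1),\ldots,o(g_k)\}<\varphi_{k-1}(\gamma)$. Then $o(M)\le \varphi_{k-1}(\gamma+o(s)+1)$.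
   Context: For $D\subseteq\mathbb{R}$ and $h:D\to\mathbb{R}$, a strictly decreasing sequence $x_1>x_2>\cdots$ in $D$ is $h$-bad if $h(x_1)>h(x_2)>\cdots$; $h$ is ordinal decreasing if there is no infinite $h$-bad sequence. For ordinal decreasing $h$, the tree $T_h$ has a vertex for each finite $h$-bad sequence $\langle x_1>\cdots>x_n\rangle$ (including the empty sequence, the root), with the parent of $\langle x_1>\cdots>x_n\rangle$ ($n\ge1$) being $\langle x_1>\cdots>x_{n-1}\rangle$. Since $T_h$ has no infinite path, each vertex $v$ gets a unique ordinal height $o(v)=\sup_{w\text{ child of }v}(o(w)+1)$; the ordinal type $o(h)$ is the height of the root. The finite Veblen functions are defined by $\varphi_0(\alpha)=\omega^\alpha$ and, for $n\in\mathbb{N}$: $\varphi_{n+1}(0)=\sup_{m\in\mathbb{N}}\varphi_n^{(m)}(0)$, $\varphi_{n+1}(\alpha+1)=\sup_{m\in\mathbb{N}}\varphi_n^{(m)}(\varphi_{n+1}(\alpha)+1)$, and $\varphi_{n+1}(\alpha)=\sup_{\beta<\alpha}\varphi_{n+1}(\beta)$ for limit $\alpha$, where $\varphi_n^{(m)}$ denotes $m$-fold composition. *)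

(* Defs.v *)
From Stdlib Require Import Reals ClassicalEpsilon List.
Open Scope R_scope.

(* Ordinals as well-founded trees with arbitrary branching.
   The tree [OSup Ix f] denotes the ordinal  sup_{i : Ix} (f i + 1).     *)
Inductive Ord : Type := OSup : forall (Ix : Type), (Ix -> Ord) -> Ord.

Definition idx (a : Ord) : Type := match a with OSup Ix _ => Ix end.
Definition child (a : Ord) : idx a -> Ord :=
  match a as a0 return idx a0 -> Ord with OSup Ix f => f end.

Fixpoint ole (a b : Ord) {struct a} : Prop :=
  match a with
  | OSup Ix f => forall i : Ix,
      match b with OSup Jx g => exists j : Jx, ole (f i) (g j) end
  end.
Definition olt (a b : Ord) : Prop :=
  match b with OSup Jx g => exists j : Jx, ole a (g j) end.

Definition ozero : Ord := OSup False (fun e => match e with end).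
Definition osucc (a : Ord) : Ord := OSup unit (fun _ => a).
Definition osup {Ix : Type} (F : Ix -> Ord) : Ord :=
  OSup {i : Ix & idx (F i)} (fun p => child (F (projT1 p)) (projT2 p)).

Fixpoint onat (n : nat) : Ord :=
  match n with O => ozero | S n' => osucc (onat n') end.
Definition oomega : Ord := OSup nat onat.

(* ordinal addition: a + sup_i (f i + 1) = max(a, sup_i (a + f i + 1)) *)
Fixpoint oadd (a b : Ord) {struct b} : Ord :=
  match b with
  | OSup Ix f => OSup (idx a + Ix)%type
      (fun p => match p with inl j => child a j | inr i => oadd a (f i) end)
  end.

Fixpoint omul (a b : Ord) {struct b} : Ord :=
  match b with
  | OSup Ix f => osup (fun i : Ix => oadd (omul a (f i)) a)
  end.

(* omega^b : omega^(sup_i (f i + 1)) = sup(1, sup_{i,n} omega^(f i) * n) *)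
Fixpoint oexpw (b : Ord) : Ord :=
  match b with
  | OSup Ix f => osup (fun p : option (Ix * nat) =>
      match p with
      | None => osucc ozero
      | Some (i, n) => omul (oexpw (f i)) (onat n)
      end)
  end.

(* Finite Veblen functions.  phi_0 = omega^_ ; for phi_{n+1} the tree
   alpha = sup_i (f i + 1) is handled by the three defining clauses:
   phi_{n+1}(alpha) = sup( phi_{n+1}(0), sup_i phi_{n+1}(f i + 1) ) with
   phi_{n+1}(0) = sup_m phi_n^(m)(0) and
   phi_{n+1}(f i + 1) = sup_m phi_n^(m)(phi_{n+1}(f i) + 1). *)
Fixpoint veblen (n : nat) : Ord -> Ord :=
  match n with
  | O => oexpw
  | S n' =>
    fix phiS (a : Ord) : Ord :=
      match a with
      | OSup Ix f => osup (fun p : (nat + Ix * nat)%type =>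
          match p with
          | inl m => Nat.iter m (veblen n') ozero
          | inr (i, m) => Nat.iter m (veblen n') (osucc (phiS (f i)))
          end)
      end
  end.

(* Ordinal decreasing functions and their ordinal type.
   A function h : D -> R is a total function R -> R together with a
   domain predicate D; values outside D are irrelevant. *)

Definition ordinal_decreasing (D : R -> Prop) (h : R -> R) : Prop :=
  ~ (exists u : nat -> R, forall n : nat,
        D (u n) /\ u (S n) < u n /\ h (u (S n)) < h (u n)).

(* finite h-bad sequences, stored in reverse: x_n :: ... :: x_1 *)
Fixpoint bad (D : R -> Prop) (h : R -> R) (l : list R) : Prop :=
  match l with
  | nil => True
  | x :: rest =>
      D x /\ match rest with
             | nil => True
             | y :: _ => x < y /\ h x < h y
             end /\ bad D h rest
  end.

Definition tchild (D : R -> Prop) (h : R -> R) (w v : list R) : Prop :=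
  exists x, w = x :: v /\ bad D h (x :: v).

Fixpoint theight (D : R -> Prop) (h : R -> R) (v : list R)
  (H : Acc (tchild D h) v) {struct H} : Ord :=
  match H with
  | Acc_intro _ H' =>
      OSup {x : R | bad D h (x :: v)}
        (fun p => theight D h (proj1_sig p :: v)
                    (H' (proj1_sig p :: v)
                        (ex_intro _ (proj1_sig p) (conj eq_refl (proj2_sig p)))))
  end.

(* ordinal type o(h): height of the root (empty sequence); it is only
   meaningful when T_h has no infinite path (default 0 otherwise). *)
Definition otype (D : R -> Prop) (h : R -> R) : Ord :=
  match excluded_middle_informative (Acc (tchild D h) nil) with
  | left H => theight D h nil H
  | right _ => ozero
  end.

Definition negR (x : R) : Prop := x < 0.
Definition nonnegR (x : R) : Prop := 0 <= x.
Definition allR (x : R) : Prop := True.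

(* Mnest M g x k t = g_1(-M(x - g_2(-M(x - ... g_k(-M(x - t)) ...)))) *)
Fixpoint Mnest (M : R -> R) (g : nat -> R -> R) (x : R) (j : nat) (t : R) : R :=
  match j with
  | O => t
  | S j' => Mnest M g x j' (g (S j') (- M (x - t)))
  end.

(* Main.v *)
Require Import Defs.
From Stdlib Require Import Reals Lra Lia ClassicalEpsilon Classical List.
Open Scope R_scope.

(* Ordinal types are bounded by rank functions for the strict partial order
   [y < x /\ h y < h x].  If u(x) = g (- M (x - t x)), then along a u-bad pair one of the
   ranks for g, M, t drops, so o(u) is at most a Hessenberg product of o(g), o(M), o(t);
   hence the innermost layer g_k (- M (x - s x)) may play the role of s in the same recursion
   with k - 1 functions.  For fixed k, the type of M on (-oo, y] is bounded by induction on the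
   rank of y for s: the points z < y with s z < s y have smaller rank, and beyond them the
   recursion looks back by at least s y, so that finitely many steps reach y.  Each such step
   stays below an ordinal closed under the bound for k - 1 functions, which is why each
   additional function moves the bound up one Veblen level. *)

(** * Order on ordinal trees: a well-founded linear preorder *)

Lemma ole_child (a b : Ord) : ole a b <-> forall i, olt (child a i) b.
Proof. destruct a, b; simpl; reflexivity. Qed.

Lemma olt_child (a b : Ord) : olt a b <-> exists j, ole a (child b j).
Proof. destruct b; simpl; reflexivity. Qed.

Lemma ole_refl (a : Ord) : ole a a.
Proof. induction a as [Ix f IH]; simpl; intro i; exists i; apply IH. Qed.

Lemma ole_trans (a b c : Ord) : ole a b -> ole b c -> ole a c.
Proof.
  revert b c; induction a as [Ix f IH]; intros [Jx g] [Kx h] Hab Hbc; simpl in *.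
  intro i. destruct (Hab i) as [j Hj]. destruct (Hbc j) as [k Hk].
  exists k. eapply IH; eauto.
Qed.

Lemma ole_olt_trans (a b c : Ord) : ole a b -> olt b c -> olt a c.
Proof.
  rewrite (olt_child b), (olt_child a). intros H [j Hj]. exists j. eapply ole_trans; eauto.
Qed.

Lemma olt_ole_trans (a b c : Ord) : olt a b -> ole b c -> olt a c.
Proof.
  rewrite (olt_child a b), (ole_child b c). intros [j Hj] H.
  eapply ole_olt_trans; eauto.
Qed.

Lemma olt_intro (a : Ord) (i : idx a) : olt (child a i) a.
Proof. apply olt_child. exists i. apply ole_refl. Qed.

Lemma olt_ole (a b : Ord) : olt a b -> ole a b.
Proof.
  revert b; induction a as [Ix f IH]; intros b H. apply ole_child; intro i; simpl in *.
  apply olt_child in H. destruct H as [j Hj].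
  apply olt_child. exists j. apply IH.
  exact (proj1 (ole_child (OSup Ix f) _) Hj i).
Qed.

Lemma olt_trans (a b c : Ord) : olt a b -> olt b c -> olt a c.
Proof. intros H K. eapply ole_olt_trans; [apply olt_ole|]; eauto. Qed.

(** Different trees can denote the same ordinal, so the induction on [a] must prove accessibility of
    every [b] with [ole b a]. *)
Lemma olt_wf : well_founded olt.
Proof.
  assert (H : forall a b, ole b a -> Acc olt b).
  { induction a as [Ix f IH]; intros b Hb. constructor; intros c Hc.
    destruct (proj1 (olt_child _ _) (olt_ole_trans _ _ _ Hc Hb)) as [i Hi].
    exact (IH i c Hi). }
  intro a. exact (H a a (ole_refl a)).
Qed.

Lemma olt_irrefl (a : Ord) : ~ olt a a.
Proof. induction (olt_wf a) as [a _ IH]. intro H. exact (IH a H H). Qed.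

(** If no child of [a] lies above [b], each child lies strictly below [b]: otherwise, by induction,
    that child would exceed every child of [b] and hence bound [b]. *)
Lemma ole_or_olt (a b : Ord) : ole a b \/ olt b a.
Proof.
  revert b; induction a as [Ix f IH]; intro b.
  destruct (classic (exists i, ole b (f i))) as [H|H]; [right; exact H|left].
  apply ole_child; simpl; intro i.
  destruct b as [Jx g]. simpl.
  apply NNPP; intro N. apply H. exists i. apply ole_child; simpl; intro j.
  destruct (IH i (g j)) as [K|K]; [|exact K]. exfalso; apply N; eauto.
Qed.

Lemma ozero_le (a : Ord) : ole ozero a.
Proof. apply ole_child. intros []. Qed.

Lemma olt_ozero (a : Ord) : ~ olt a ozero.
Proof. intros [[] _]. Qed.

Lemma olt_osucc (a b : Ord) : olt a (osucc b) <-> ole a b.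
Proof. simpl. split; [intros [_ H]; exact H | intro H; exists tt; exact H]. Qed.

Lemma ole_osucc (a b : Ord) : ole (osucc a) b <-> olt a b.
Proof. rewrite ole_child. simpl. split; [intro H; exact (H tt) | intros H _; exact H]. Qed.

Lemma osucc_mono (a b : Ord) : ole a b -> ole (osucc a) (osucc b).
Proof. intro H. apply ole_osucc, olt_osucc, H. Qed.

Lemma olt_osup {Ix : Type} (F : Ix -> Ord) (a : Ord) :
  olt a (osup F) <-> exists i, olt a (F i).
Proof.
  unfold osup; simpl; split.
  - intros [[i j] H]. exists i. apply olt_child. exists j. exact H.
  - intros [i H]. apply olt_child in H. destruct H as [j H]. exists (existT _ i j). exact H.
Qed.

Lemma ole_from_olt (a b : Ord) : (forall x, olt x a -> olt x b) -> ole a b.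
Proof. intro H. apply ole_child. intro i. apply H, olt_intro. Qed.

Lemma le_osup {Ix : Type} (F : Ix -> Ord) (i : Ix) : ole (F i) (osup F).
Proof. apply ole_from_olt. intros x Hx. apply olt_osup. eauto. Qed.

Lemma strict_mono_ge (F : Ord -> Ord) :
  (forall a b, olt a b -> olt (F a) (F b)) -> forall a, ole a (F a).
Proof.
  intros H a. induction a as [Ix f IH]. apply ole_child; simpl; intro i.
  eapply ole_olt_trans; [apply IH|]. apply H. exact (olt_intro (OSup Ix f) i).
Qed.

(** * Ordinal addition, multiplication and powers of omega *)

Lemma olt_oadd (x a b : Ord) :
  olt x (oadd a b) <-> olt x a \/ exists i, ole x (oadd a (child b i)).
Proof.
  destruct b as [Ix f]; simpl. rewrite (olt_child x a). split.
  - intros [[j|i] H]; eauto.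
  - intros [[j H]|[i H]]; [exists (inl j)|exists (inr i)]; exact H.
Qed.

Lemma oadd_le_l (a b : Ord) : ole a (oadd a b).
Proof. apply ole_from_olt. intros x Hx. apply olt_oadd. auto. Qed.

Lemma oadd_le_mono (a a' b b' : Ord) : ole a a' -> ole b b' -> ole (oadd a b) (oadd a' b').
Proof.
  intro Ha. revert b'; induction b as [Ix f IH]; intros b' Hb.
  apply ole_from_olt. intros x Hx. apply olt_oadd in Hx. apply olt_oadd.
  destruct Hx as [Hx|[i Hx]]; [left; eapply olt_ole_trans; eauto|right].
  apply ole_child with (i := i) in Hb. apply olt_child in Hb. destruct Hb as [j Hj].
  exists j. eapply ole_trans; [exact Hx|]. apply IH, Hj.
Qed.

Lemma oadd_lt_mono (a b b' : Ord) : olt b b' -> olt (oadd a b) (oadd a b').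
Proof.
  intro H. apply olt_child in H. destruct H as [j H]. apply olt_oadd. right. exists j.
  apply oadd_le_mono; [apply ole_refl|exact H].
Qed.

Lemma oadd_lt_cancel (a b b' : Ord) : olt (oadd a b) (oadd a b') -> olt b b'.
Proof.
  intro H. destruct (ole_or_olt b' b) as [K|K]; [|exact K].
  exfalso. eapply olt_irrefl, olt_ole_trans; [exact H|].
  apply oadd_le_mono; [apply ole_refl|exact K].
Qed.

Lemma oadd_le_r (a b : Ord) : ole b (oadd a b).
Proof. apply (strict_mono_ge (oadd a)). apply oadd_lt_mono. Qed.

(** Left subtraction of [c] from [z]. One descends from [d] through children until [c + e] no longer
    exceeds [z]; equality of ordinals is expressed by [ole] in both directions. *)
Lemma oadd_interval (c d z : Ord) : ole c z -> olt z (oadd c d) ->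
  exists e, olt e d /\ ole z (oadd c e) /\ ole (oadd c e) z.
Proof.
  intro Hc. induction d as [Ix f IH]; intro Hz.
  apply olt_oadd in Hz. destruct Hz as [Hz|[i Hz]].
  - exfalso. eapply olt_irrefl, ole_olt_trans; eauto.
  - destruct (ole_or_olt (oadd c (f i)) z) as [K|K].
    + exists (f i). split; [exact (olt_intro (OSup Ix f) i)|auto].
    + destruct (IH i K) as [e [He1 He2]]. exists e. split; [|exact He2].
      eapply olt_trans; [exact He1|exact (olt_intro (OSup Ix f) i)].
Qed.

Lemma olt_omul (x a b : Ord) :
  olt x (omul a b) <-> exists i, olt x (oadd (omul a (child b i)) a).
Proof. destruct b as [Ix f]. apply olt_osup. Qed.

Lemma omul_le_mono (a a' b b' : Ord) : ole a a' -> ole b b' -> ole (omul a b) (omul a' b').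
Proof.
  intro Ha. revert b'; induction b as [Ix f IH]; intros b' Hb.
  apply ole_from_olt. intros x Hx. apply olt_omul in Hx. apply olt_omul.
  destruct Hx as [i Hx].
  apply ole_child with (i := i) in Hb. apply olt_child in Hb. destruct Hb as [j Hj].
  exists j. eapply olt_ole_trans; [exact Hx|]. apply oadd_le_mono; auto.
Qed.

Lemma omul_osucc (a b : Ord) : ole (oadd (omul a b) a) (omul a (osucc b)).
Proof. apply ole_from_olt. intros x Hx. apply olt_omul. exists tt. exact Hx. Qed.

Lemma omul_osucc_le (a b : Ord) : ole (omul a (osucc b)) (oadd (omul a b) a).
Proof. apply ole_from_olt. intros x Hx. apply olt_omul in Hx. destruct Hx as [i Hx]. exact Hx. Qed.

Lemma le_omul_osucc (a b : Ord) : ole a (omul a (osucc b)).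
Proof. eapply ole_trans; [|apply omul_osucc]. apply oadd_le_r. Qed.

Lemma olt_oexpw (x b : Ord) :
  olt x (oexpw b) <-> ole x ozero \/ exists i n, olt x (omul (oexpw (child b i)) (onat n)).
Proof.
  destruct b as [Ix f]. simpl oexpw. rewrite olt_osup. split.
  - intros [[[i n]|] H]; [right; eauto|left; apply olt_osucc, H].
  - intros [H|[i [n H]]]; [exists None; apply olt_osucc, H|exists (Some (i, n)); exact H].
Qed.

Lemma oexpw_pos (b : Ord) : olt ozero (oexpw b).
Proof. apply olt_oexpw. left. apply ole_refl. Qed.

Lemma oexpw_le_mono (b b' : Ord) : ole b b' -> ole (oexpw b) (oexpw b').
Proof.
  revert b'; induction b as [Ix f IH]; intros b' Hb.
  apply ole_from_olt. intros x Hx. apply olt_oexpw in Hx. apply olt_oexpw.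
  destruct Hx as [Hx|[i [n Hx]]]; [left; exact Hx|right].
  apply ole_child with (i := i) in Hb. apply olt_child in Hb. destruct Hb as [j Hj].
  exists j, n. eapply olt_ole_trans; [exact Hx|].
  apply omul_le_mono; [apply IH, Hj|apply ole_refl].
Qed.

Lemma oexpw_mul_lt (b b' : Ord) (n : nat) :
  olt b b' -> olt (omul (oexpw b) (onat n)) (oexpw b').
Proof.
  intro H. apply olt_child in H. destruct H as [j Hj].
  apply olt_oexpw. right. exists j, (S n).
  eapply olt_ole_trans; [|apply omul_osucc].
  apply ole_olt_trans with (oadd (omul (oexpw (child b' j)) (onat n)) ozero).
  - eapply ole_trans; [|apply oadd_le_l].
    apply omul_le_mono; [apply oexpw_le_mono, Hj|apply ole_refl].
  - apply oadd_lt_mono, oexpw_pos.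
Qed.

Lemma oexpw_lt_mono (b b' : Ord) : olt b b' -> olt (oexpw b) (oexpw b').
Proof.
  intro H. eapply ole_olt_trans; [|apply (oexpw_mul_lt b b' 1 H)]. apply le_omul_osucc.
Qed.

Lemma oexpw_ge (a : Ord) : ole a (oexpw a).
Proof. apply strict_mono_ge, oexpw_lt_mono. Qed.

(** * Natural sum and additively closed ordinals *)

(* Hessenberg's natural sum. *)
Fixpoint nadd (a : Ord) : Ord -> Ord :=
  match a with
  | OSup Ix f => fix nadda (b : Ord) : Ord :=
      match b with
      | OSup Jx g => OSup (Ix + Jx)%type
          (fun p => match p with inl i => nadd (f i) b | inr j => nadda (g j) end)
      end
  end.

Lemma olt_nadd (x a b : Ord) : olt x (nadd a b) <->
  (exists i, ole x (nadd (child a i) b)) \/ (exists j, ole x (nadd a (child b j))).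
Proof.
  destruct a as [Ix f], b as [Jx g]; simpl. split.
  - intros [[i|j] H]; eauto.
  - intros [[i H]|[j H]]; [exists (inl i)|exists (inr j)]; exact H.
Qed.

Lemma nadd_le_mono (a a' b b' : Ord) : ole a a' -> ole b b' -> ole (nadd a b) (nadd a' b').
Proof.
  revert a' b b'; induction a as [Ix f IHa]; intros a' b b' Ha.
  revert b'; induction b as [Jx g IHb]; intros b' Hb.
  apply ole_from_olt. intros x Hx. apply olt_nadd in Hx. apply olt_nadd.
  destruct Hx as [[i Hx]|[j Hx]]; [left|right].
  - destruct (proj1 (olt_child _ _) (proj1 (ole_child _ _) Ha i)) as [i' Hi].
    exists i'. eapply ole_trans; [exact Hx|]. apply IHa; assumption.
  - destruct (proj1 (olt_child _ _) (proj1 (ole_child _ _) Hb j)) as [j' Hj].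
    exists j'. eapply ole_trans; [exact Hx|]. apply IHb; assumption.
Qed.

Lemma nadd_lt_l (a a' b b' : Ord) : olt a a' -> ole b b' -> olt (nadd a b) (nadd a' b').
Proof.
  intros H Hb. apply olt_child in H. destruct H as [i H]. apply olt_nadd. left. exists i.
  apply nadd_le_mono; assumption.
Qed.

Lemma nadd_lt_r (a a' b b' : Ord) : ole a a' -> olt b b' -> olt (nadd a b) (nadd a' b').
Proof.
  intros Ha H. apply olt_child in H. destruct H as [i H]. apply olt_nadd. right. exists i.
  apply nadd_le_mono; assumption.
Qed.

Lemma nadd_ge_l (a b : Ord) : ole a (nadd a b).
Proof.
  apply (strict_mono_ge (fun a => nadd a b)). intros. apply nadd_lt_l; auto using ole_refl.
Qed.

Lemma nadd_ge_r (a b : Ord) : ole b (nadd a b).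
Proof.
  apply (strict_mono_ge (nadd a)). intros. apply nadd_lt_r; auto using ole_refl.
Qed.

(** For [c] above zero these are the additively principal ordinals. Closure is stated for the
    natural sum because unions of sets are bounded by natural sums. *)
Definition add_closed (c : Ord) : Prop :=
  forall x y, olt x c -> olt y c -> olt (nadd x y) c.

(** Nested induction on [r], [q], [e], [e']. Going below one summand either lowers its remainder, or
    lowers its multiple of [c] at the price of an arbitrary new remainder below [c]; the latter is
    absorbed because the coefficient has dropped. *)
Lemma nadd_omul (c : Ord) : add_closed c -> forall r q e e', olt e c -> olt e' c ->
  ole (nadd (oadd (omul c r) e) (oadd (omul c q) e')) (oadd (omul c (nadd r q)) (nadd e e')).
Proof.
  intro Hc.
  induction r as [r IHr] using (well_founded_ind olt_wf).
  induction q as [q IHq] using (well_founded_ind olt_wf).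
  induction e as [e IHe] using (well_founded_ind olt_wf).
  induction e' as [e' IHe'] using (well_founded_ind olt_wf).
  intros He He'.
  assert (Hbelow : forall p d, olt p (nadd r q) -> olt d c ->
    olt (oadd (omul c p) d) (oadd (omul c (nadd r q)) (nadd e e'))).
  { intros p d Hp Hd. apply olt_ole_trans with (oadd (omul c p) c).
    - apply oadd_lt_mono, Hd.
    - eapply ole_trans; [apply omul_osucc|]. eapply ole_trans; [|apply oadd_le_l].
      apply omul_le_mono; [apply ole_refl|apply ole_osucc, Hp]. }
  assert (Hsplit : forall p x, olt x (omul c p) ->
    exists p' d, olt p' p /\ olt d c /\ ole x (oadd (omul c p') d)).
  { intros p x Hx. apply olt_omul in Hx. destruct Hx as [i Hx].
    exists (child p i).
    destruct (ole_or_olt (omul c (child p i)) x) as [K|K].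
    - destruct (oadd_interval _ _ _ K Hx) as [d [Hd [Hd' _]]].
      exists d. auto using olt_intro.
    (* Here [x] is already below the multiple itself, so any remainder below [c] will do, and [e] is
       at hand. *)
    - exists e. split; [apply olt_intro|split; [exact He|]].
      eapply ole_trans; [apply olt_ole, K|apply oadd_le_l]. }
  apply ole_child. intro i0.
  pose proof (olt_intro _ i0) as Hx. revert Hx. generalize (child _ i0) as x. intros x Hx.
  apply olt_nadd in Hx.
  destruct Hx as [[i Hx]|[i Hx]]; (eapply ole_olt_trans; [exact Hx|]); clear Hx.
  - pose proof (olt_intro _ i) as Hy. revert Hy. generalize (child _ i) as y. intros y Hy.
    apply olt_oadd in Hy. destruct Hy as [Hy|[j Hy]].
    + destruct (Hsplit _ _ Hy) as [r' [d [Hr' [Hd Hy']]]].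
      eapply ole_olt_trans; [apply nadd_le_mono; [exact Hy'|apply ole_refl]|].
      eapply ole_olt_trans; [apply IHr; assumption|].
      apply Hbelow; [apply nadd_lt_l; auto using ole_refl|apply Hc; assumption].
    + eapply ole_olt_trans; [apply nadd_le_mono; [exact Hy|apply ole_refl]|].
      assert (Hj := olt_intro e j).
      eapply ole_olt_trans; [apply IHe; [assumption|eapply olt_trans; eauto|assumption]|].
      apply oadd_lt_mono, nadd_lt_l; auto using ole_refl.
  - pose proof (olt_intro _ i) as Hy. revert Hy. generalize (child _ i) as y. intros y Hy.
    apply olt_oadd in Hy. destruct Hy as [Hy|[j Hy]].
    + destruct (Hsplit _ _ Hy) as [q' [d [Hq' [Hd Hy']]]].
      eapply ole_olt_trans; [apply nadd_le_mono; [apply ole_refl|exact Hy']|].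
      eapply ole_olt_trans; [apply IHq; assumption|].
      apply Hbelow; [apply nadd_lt_r; auto using ole_refl|apply Hc; assumption].
    + eapply ole_olt_trans; [apply nadd_le_mono; [apply ole_refl|exact Hy]|].
      assert (Hj := olt_intro e' j).
      eapply ole_olt_trans; [apply IHe'; [assumption|assumption|eapply olt_trans; eauto]|].
      apply oadd_lt_mono, nadd_lt_r; auto using ole_refl.
Qed.

Lemma onat_add (n m : nat) : ole (nadd (onat n) (onat m)) (onat (n + m)).
Proof.
  revert m; induction n as [|n IHn]; intro m.
  - induction m as [|m IHm]; apply ole_from_olt; intros x Hx; apply olt_nadd in Hx;
      destruct Hx as [[[] _]|[j Hx]]; [destruct j|].
    apply olt_osucc. eapply ole_trans; [exact Hx|exact IHm].
  - induction m as [|m IHm]; apply ole_from_olt; intros x Hx; apply olt_nadd in Hx;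
      apply olt_osucc; destruct Hx as [[j Hx]|[j Hx]].
    + eapply ole_trans; [exact Hx|]. apply (IHn 0%nat).
    + destruct j.
    + eapply ole_trans; [exact Hx|]. apply (IHn (S m)).
    + eapply ole_trans; [exact Hx|]. rewrite Nat.add_succ_r. exact IHm.
Qed.

(** Two nonzero points below [omega^c] lie below finite multiples of one [omega^d] with [d < c]. By
    induction [omega^d] is additively closed, so [nadd_omul] with zero remainders adds the two
    coefficients. *)
Lemma oexpw_add_closed (c : Ord) : add_closed (oexpw c).
Proof.
  induction c as [c IH] using (well_founded_ind olt_wf). intros x y Hx Hy.
  assert (Hz : forall y, olt y (oexpw c) -> ole y ozero \/
    exists i n, ole y (omul (oexpw (child c i)) (onat n))).
  { intros z H. apply olt_oexpw in H. destruct H as [H|[i [n H]]]; [auto|].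
    right. exists i, n. apply olt_ole, H. }
  assert (H0l : forall u v, ole u ozero -> ole (nadd u v) v).
  { intros u v Hu. induction v as [Ix f IHv]. apply ole_from_olt. intros z H.
    apply olt_nadd in H. destruct H as [[i H]|[j H]].
    - destruct (olt_ozero (child u i)). eapply olt_ole_trans; [apply olt_intro|exact Hu].
    - eapply ole_olt_trans; [exact H|]. eapply ole_olt_trans; [apply IHv|].
      exact (olt_intro (OSup Ix f) j). }
  assert (H0r : forall u v, ole u ozero -> ole (nadd v u) v).
  { intros u v Hu. induction v as [Ix f IHv]. apply ole_from_olt. intros z H.
    apply olt_nadd in H. destruct H as [[j H]|[i H]].
    - eapply ole_olt_trans; [exact H|]. eapply ole_olt_trans; [apply IHv|].
      exact (olt_intro (OSup Ix f) j).
    - destruct (olt_ozero (child u i)). eapply olt_ole_trans; [apply olt_intro|exact Hu]. }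
  destruct (Hz x Hx) as [Hx0|[i [n Hxi]]].
  { eapply ole_olt_trans; [apply H0l, Hx0|exact Hy]. }
  destruct (Hz y Hy) as [Hy0|[j [m Hyj]]].
  { eapply ole_olt_trans; [apply H0r, Hy0|exact Hx]. }
  assert (Hd : exists d, olt d c /\ ole (child c i) d /\ ole (child c j) d).
  { destruct (ole_or_olt (child c i) (child c j)) as [K|K].
    - exists (child c j). auto using olt_intro, ole_refl.
    - exists (child c i). auto using olt_intro, ole_refl, olt_ole. }
  destruct Hd as [d [Hdc [Hid Hjd]]].
  eapply ole_olt_trans; [|apply (oexpw_mul_lt d c (n + m) Hdc)].
  set (w := oexpw d).
  apply ole_trans with
    (nadd (oadd (omul w (onat n)) ozero) (oadd (omul w (onat m)) ozero)).
  { apply nadd_le_mono; (eapply ole_trans; [|apply oadd_le_l]); eapply ole_trans; eauto;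
      apply omul_le_mono; auto using ole_refl; apply oexpw_le_mono; assumption. }
  eapply ole_trans; [apply nadd_omul; [apply IH, Hdc|apply oexpw_pos|apply oexpw_pos]|].
  apply ole_from_olt. intros z H. apply olt_oadd in H. destruct H as [H|[k H]].
  - eapply olt_ole_trans; [exact H|]. apply omul_le_mono; [apply ole_refl|apply onat_add].
  - destruct k as [[]|[]].
Qed.

(** The point [x] is at most [c * r + d] with [d < c], and the natural sum of [d] and [y] is again
    below [c]. *)
Lemma omul_absorb (c r x y : Ord) : add_closed c -> olt x (omul c (osucc r)) -> olt y c ->
  olt (nadd x y) (omul c (osucc r)).
Proof.
  intros Hc Hx Hy.
  assert (H : exists d, olt d c /\ ole x (oadd (omul c r) d)).
  { pose proof (olt_ole_trans _ _ _ Hx (omul_osucc_le c r)) as Hx'.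
    destruct (ole_or_olt (omul c r) x) as [K|K].
    - destruct (oadd_interval _ _ _ K Hx') as [d [Hd [Hd' _]]]. eauto.
    - exists y. split; [exact Hy|]. eapply ole_trans; [apply olt_ole, K|apply oadd_le_l]. }
  destruct H as [d [Hd Hxd]].
  (* Reading [y] as [c * 0 + y] brings both summands into the form required by [nadd_omul]. *)
  apply ole_olt_trans with (nadd (oadd (omul c r) d) (oadd (omul c ozero) y)).
  { apply nadd_le_mono; [exact Hxd|apply oadd_le_r]. }
  eapply ole_olt_trans; [apply nadd_omul; assumption|].
  eapply olt_ole_trans; [apply oadd_lt_mono, (Hc d y Hd Hy)|].
  eapply ole_trans; [|apply omul_osucc].
  apply oadd_le_mono; [|apply ole_refl]. apply omul_le_mono; [apply ole_refl|].
  clear. induction r as [Ix f IH]. apply ole_from_olt. intros z H. apply olt_nadd in H.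
  destruct H as [[i H]|[[] _]]. eapply ole_olt_trans; [exact H|].
  eapply ole_olt_trans; [apply IH|]. exact (olt_intro (OSup Ix f) i).
Qed.

Lemma oadd_le_nadd (a b : Ord) : ole (oadd a b) (nadd a b).
Proof.
  induction b as [Ix f IH]. apply ole_from_olt. intros x H. apply olt_oadd in H.
  destruct H as [H|[i H]].
  - eapply olt_ole_trans; [exact H|apply nadd_ge_l].
  - apply olt_nadd. right. exists i. eapply ole_trans; [exact H|apply IH].
Qed.

(** A crude bound; it serves to keep such products below ordinals closed under natural sum and
    powers of omega. *)
Lemma omul_oexpw_le (c b : Ord) : ole (omul (oexpw c) b) (oexpw (nadd c b)).
Proof.
  induction b as [Ix f IH]. apply ole_from_olt. intros x H. apply olt_omul in H.
  destruct H as [i H]. eapply olt_trans; [exact H|]. clear x H.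
  assert (Hi := olt_intro (OSup Ix f) i).
  eapply ole_olt_trans; [apply oadd_le_nadd|]. apply oexpw_add_closed.
  - eapply ole_olt_trans; [apply IH|]. apply oexpw_lt_mono, nadd_lt_r; auto using ole_refl.
  - apply oexpw_lt_mono. eapply ole_olt_trans; [apply nadd_ge_l|].
    eapply nadd_lt_r; [apply ole_refl|exact Hi].
Qed.

(** * Monotonicity and closure properties of the Veblen functions *)

Lemma olt_veblen (n : nat) (x a : Ord) : olt x (veblen (S n) a) <->
  (exists m, olt x (Nat.iter m (veblen n) ozero)) \/
  (exists i m, olt x (Nat.iter m (veblen n) (osucc (veblen (S n) (child a i))))).
Proof.
  destruct a as [Ix f]. cbn [veblen]. rewrite olt_osup. split.
  - intros [[m|[i m]] H]; [left|right]; eauto.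
  - intros [[m H]|[i [m H]]]; [exists (inl m)|exists (inr (i, m))]; exact H.
Qed.

Lemma iter_le_mono (F : Ord -> Ord) (HF : forall a b, ole a b -> ole (F a) (F b))
  (m : nat) (a b : Ord) : ole a b -> ole (Nat.iter m F a) (Nat.iter m F b).
Proof. intro H. induction m; simpl; auto. Qed.

Lemma veblen_le_mono (n : nat) (a b : Ord) : ole a b -> ole (veblen n a) (veblen n b).
Proof.
  revert a b. induction n as [|n IHn]; [exact oexpw_le_mono|].
  induction a as [Ix f IH]; intros b Hb.
  apply ole_from_olt. intros x Hx. apply olt_veblen in Hx. apply olt_veblen.
  destruct Hx as [Hx|[i [m Hx]]]; [left; exact Hx|right].
  apply ole_child with (i := i) in Hb. apply olt_child in Hb. destruct Hb as [j Hj].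
  exists j, m. eapply olt_ole_trans; [exact Hx|].
  apply iter_le_mono; [exact IHn|]. apply osucc_mono. apply IH, Hj.
Qed.

Lemma veblen_lt_mono (n : nat) (a b : Ord) : olt a b -> olt (veblen n a) (veblen n b).
Proof.
  destruct n as [|n]; [exact (oexpw_lt_mono a b)|]. intro H.
  apply olt_child in H. destruct H as [j Hj]. apply olt_veblen. right. exists j, 0%nat.
  apply olt_osucc, veblen_le_mono, Hj.
Qed.

Lemma veblen_ge (n : nat) (a : Ord) : ole a (veblen n a).
Proof. apply strict_mono_ge, veblen_lt_mono. Qed.

Lemma veblen_pos (n : nat) (a : Ord) : olt ozero (veblen n a).
Proof.
  revert a; induction n as [|n IH]; intro a; [apply oexpw_pos|].
  apply olt_veblen. left. exists 1%nat. apply IH.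
Qed.

(** A point below the [m]-th iterate of a seed is sent below the iterate numbered [m + 1] of the
    same seed. *)
Lemma veblen_closed (n : nat) (x a : Ord) :
  olt x (veblen (S n) a) -> olt (veblen n x) (veblen (S n) a).
Proof.
  intro H. apply olt_veblen in H. apply olt_veblen.
  destruct H as [[m H]|[i [m H]]]; [left; exists (S m)|right; exists i, (S m)];
    apply veblen_lt_mono, H.
Qed.

(** Both points lie below iterates of [veblen n]. Passing to the larger seed and to enough
    iterations puts them below one common iterate, which is additively closed by induction. *)
Lemma veblen_add_closed (n : nat) (a : Ord) : add_closed (veblen n a).
Proof.
  revert a. induction n as [|n IHn]; intro a; [apply oexpw_add_closed|].
  assert (Hseed : forall x, olt x (veblen (S n) a) -> exists z m,
    olt x (Nat.iter m (veblen n) z) /\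
    forall m', ole (Nat.iter m' (veblen n) z) (veblen (S n) a)).
  { intros x Hx. apply olt_veblen in Hx. destruct Hx as [[m H]|[i [m H]]];
      do 2 eexists; (split; [exact H|]); intro m'; apply ole_from_olt; intros y Hy;
      apply olt_veblen; eauto. }
  assert (Hinc : forall z m, ole z (Nat.iter m (veblen n) z)).
  { intros z m. induction m as [|m IH]; [apply ole_refl|].
    eapply ole_trans; [exact IH|apply veblen_ge]. }
  (* The additional iteration guarantees that the common bound is a value of [veblen n], even when
     [m] and [m'] are both zero. *)
  assert (Hcommon : forall z m m',
    ole (Nat.iter m (veblen n) z) (Nat.iter (S (m + m')) (veblen n) z)).
  { intros z m m'. replace (S (m + m')) with (m + S m')%nat by lia.
    rewrite Nat.iter_add. apply iter_le_mono; [apply veblen_le_mono|apply Hinc]. }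
  intros x y Hx Hy.
  destruct (Hseed x Hx) as [z [m [Hxz Hz]]]. destruct (Hseed y Hy) as [z' [m' [Hyz Hz']]].
  assert (Hw : exists w, ole z w /\ ole z' w /\
    forall m', ole (Nat.iter m' (veblen n) w) (veblen (S n) a)).
  { destruct (ole_or_olt z z') as [K|K]; [exists z'|exists z];
      auto using ole_refl, olt_ole. }
  destruct Hw as [w [Hzw [Hzw' Hwa]]].
  apply olt_ole_trans with (Nat.iter (S (m + m')) (veblen n) w); [|apply Hwa].
  apply IHn.
  - eapply olt_ole_trans; [exact Hxz|]. eapply ole_trans; [|apply Hcommon].
    apply iter_le_mono; [apply veblen_le_mono|exact Hzw].
  - eapply olt_ole_trans; [exact Hyz|].
    replace (m + m')%nat with (m' + m)%nat by lia. eapply ole_trans; [|apply Hcommon].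
    apply iter_le_mono; [apply veblen_le_mono|exact Hzw'].
Qed.

Lemma veblen_osucc_closed (n : nat) (x a : Ord) :
  olt x (veblen (S n) a) -> olt (osucc x) (veblen (S n) a).
Proof.
  intro H. apply ole_olt_trans with (nadd x (osucc ozero)).
  - apply ole_osucc, olt_nadd. right. exists tt. apply nadd_ge_l.
  - apply veblen_add_closed; [exact H|].
    eapply ole_olt_trans; [|apply veblen_closed, veblen_pos].
    apply ole_osucc, veblen_pos.
Qed.

(** For the higher levels, [x] is below [veblen (S n) (osucc x)], so by induction [omega^x] is below
    it too, and that value stays below the next level. *)
Lemma veblen_oexpw_closed (n : nat) (x a : Ord) :
  olt x (veblen (S n) a) -> olt (oexpw x) (veblen (S n) a).
Proof.
  revert x a. induction n as [|n IH]; intros x a Hx; [exact (veblen_closed 0 x a Hx)|].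
  eapply olt_trans; [|apply veblen_closed, veblen_osucc_closed, Hx].
  apply IH. apply (proj1 (ole_osucc _ _)). apply veblen_ge.
Qed.

(** * Bounds by rank functions: gluing, unions and products *)

(** Any rank function with values below [a] is accepted as witness, so that bounds pass directly to
    subsets and along pullbacks. *)
Definition rk {X : Type} (S : X -> Prop) (R : X -> X -> Prop) (a : Ord) : Prop :=
  exists rho : X -> Ord, (forall x, S x -> olt (rho x) a) /\
    (forall x y, S x -> S y -> R y x -> olt (rho y) (rho x)).

Lemma rk_pullback {X Y : Type} (S : X -> Prop) (T : Y -> Prop) (R : X -> X -> Prop)
  (Q : Y -> Y -> Prop) (F : X -> Y) (a b : Ord) :
  rk T Q a -> ole a b -> (forall x, S x -> T (F x)) ->
  (forall x y, S x -> S y -> R y x -> Q (F y) (F x)) -> rk S R b.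
Proof.
  intros [rho [H1 H2]] Hab HF HR. exists (fun x => rho (F x)). split; [|auto].
  intros x Hx. eapply olt_ole_trans; eauto.
Qed.

Lemma rk_weaken {X : Type} (S T : X -> Prop) (R : X -> X -> Prop) (a b : Ord) :
  rk T R a -> ole a b -> (forall x, S x -> T x) -> rk S R b.
Proof. intros H Hab HS. eapply (rk_pullback S T R R (fun x => x)); eauto. Qed.

Fixpoint acc_rank {X : Type} (R : X -> X -> Prop) (x : X) (H : Acc R x) {struct H} : Ord :=
  match H with
  | Acc_intro _ H' => OSup {y : X | R y x}
      (fun p => acc_rank R (proj1_sig p) (H' (proj1_sig p) (proj2_sig p)))
  end.

(** The least rank function. Its default [ozero] off the well-founded part keeps [rank_le] free of
    an accessibility hypothesis. *)
Definition rank {X : Type} (R : X -> X -> Prop) (x : X) : Ord :=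
  match excluded_middle_informative (Acc R x) with
  | left H => acc_rank R x H
  | right _ => ozero
  end.

Lemma acc_rank_irrel {X : Type} (R : X -> X -> Prop) (x : X) (H : Acc R x) :
  forall K : Acc R x, ole (acc_rank R x H) (acc_rank R x K).
Proof.
  revert x H. fix IH 2. intros x [H] [K]. simpl. intros [y Hy]. exists (exist _ y Hy).
  apply IH.
Qed.

Lemma rank_lt {X : Type} (R : X -> X -> Prop) (x y : X) :
  Acc R x -> R y x -> olt (rank R y) (rank R x).
Proof.
  intros Hx Hy. unfold rank at 2. destruct (excluded_middle_informative _) as [[H]|N];
    [|contradiction].
  simpl. exists (exist _ y Hy). simpl. unfold rank.
  destruct (excluded_middle_informative _) as [K|N]; [apply acc_rank_irrel|].
  destruct (N (H y Hy)).
Qed.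

Lemma rank_le {X : Type} (R : X -> X -> Prop) (x : X) (a : Ord) :
  (forall y, R y x -> olt (rank R y) a) -> ole (rank R x) a.
Proof.
  intro H. unfold rank. destruct (excluded_middle_informative _) as [[K]|N];
    [|apply ozero_le].
  apply ole_child. intros [y Hy]. simpl. eapply ole_olt_trans; [|apply (H y Hy)].
  unfold rank. destruct (excluded_middle_informative _) as [K'|N]; [apply acc_rank_irrel|].
  destruct (N (K y Hy)).
Qed.

Definition restr {X : Type} (S : X -> Prop) (R : X -> X -> Prop) (y x : X) : Prop :=
  S y /\ S x /\ R y x.

(** Descending inside [S] from a point of [T] never leaves [T], so the canonical rank for [S] at
    that point is dominated by any rank function on [T]. *)
Lemma rk_rank_lt {X : Type} (S T : X -> Prop) (R : X -> X -> Prop) (a : Ord) :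
  rk T R a -> (forall x y, T x -> S y -> R y x -> T y) ->
  forall x, T x -> Acc (restr S R) x /\ olt (rank (restr S R) x) a.
Proof.
  intros [rho [H1 H2]] Hcl.
  assert (H : forall b x, ole (rho x) b -> T x ->
    Acc (restr S R) x /\ ole (rank (restr S R) x) (rho x)).
  { induction b as [b IH] using (well_founded_ind olt_wf). intros x Hb Hx.
    assert (Hp : forall y, restr S R y x ->
      Acc (restr S R) y /\ olt (rank (restr S R) y) (rho x)).
    { intros y [Sy [_ Ry]]. assert (Ty := Hcl x y Hx Sy Ry).
      assert (Hlt := H2 x y Hx Ty Ry).
      destruct (IH (rho y) (olt_ole_trans _ _ _ Hlt Hb) y (ole_refl _) Ty) as [K1 K2].
      split; [exact K1|]. eapply ole_olt_trans; eauto. }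
    split; [constructor; intros; apply Hp; assumption|].
    apply rank_le. intros; apply Hp; assumption. }
  intros x Hx. destruct (H (rho x) x (ole_refl _) Hx) as [K1 K2].
  split; [exact K1|]. eapply ole_olt_trans; [exact K2|auto].
Qed.

Lemma rk_of_rank {X : Type} (S : X -> Prop) (R : X -> X -> Prop) (a : Ord) :
  (forall x, S x -> Acc (restr S R) x /\ olt (rank (restr S R) x) a) -> rk S R a.
Proof.
  intro H. exists (rank (restr S R)). split; [intros; apply H; assumption|].
  intros x y Sx Sy Ryx. apply rank_lt; [apply H, Sx|]. split; auto.
Qed.

(** Gluing: the local rank functions need not agree, but each dominates the canonical rank of [S]. A
    union of downward closed pieces with a common bound therefore keeps that bound. *)
Lemma rk_local {X : Type} (S : X -> Prop) (R : X -> X -> Prop) (a : Ord) :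
  (forall x, S x -> exists T, T x /\
     (forall y z, T y -> S z -> R z y -> T z) /\ rk T R a) -> rk S R a.
Proof.
  intro H. apply rk_of_rank. intros x Sx. destruct (H x Sx) as [T [Tx [Hcl HT]]].
  exact (rk_rank_lt S T R a HT Hcl x Tx).
Qed.

Definition trans {X : Type} (R : X -> X -> Prop) : Prop :=
  forall x y z, R x y -> R y z -> R x z.

(** Transitivity makes the set of points below [x] downward closed, so a bound on that set bounds
    the canonical rank of [x]. *)
Lemma rk_below {X : Type} (S : X -> Prop) (R : X -> X -> Prop) (a : Ord) : trans R ->
  (forall x, S x -> exists b, olt b a /\ rk (fun y => S y /\ R y x) R b) -> rk S R a.
Proof.
  intros HR H. apply rk_of_rank. intros x Sx. destruct (H x Sx) as [b [Hb HT]].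
  assert (K := rk_rank_lt S _ R b HT (fun y z HTy Sz Rzy => conj Sz (HR _ _ _ Rzy (proj2 HTy)))).
  split.
  - constructor. intros y [Sy [_ Ry]]. apply K; auto.
  - eapply ole_olt_trans; [|exact Hb]. apply rank_le. intros y [Sy [_ Ry]]. apply K; auto.
Qed.

Lemma rk_union {X : Type} (S T : X -> Prop) (R : X -> X -> Prop) (a b : Ord) : trans R ->
  rk S R a -> rk T R b -> rk (fun x => S x \/ T x) R (nadd a b).
Proof.
  intros HR [r [Hr1 Hr2]] [q [Hq1 Hq2]].
  (* [sub U f] extends a rank function from [U] to all points: it is at most [f] on [U], never
     increases downwards, and drops strictly on moving down to a point of [U]. Hence the natural sum
     of the two extensions drops at every step. *)
  set (sub := fun (U : X -> Prop) (f : X -> Ord) (x : X) =>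
    OSup {y : X | U y /\ R y x} (fun p => f (proj1_sig p))).
  assert (Hmono : forall U f x y, R y x -> ole (sub U f y) (sub U f x)).
  { intros U f x y Hyx. apply ole_child. intros [z [Uz Rz]]. simpl.
    exists (exist _ z (conj Uz (HR _ _ _ Rz Hyx))). apply ole_refl. }
  assert (Hle : forall (U : X -> Prop) f x, (forall y, U y -> R y x -> olt (f y) (f x)) ->
    ole (sub U f x) (f x)).
  { intros U f x H. apply ole_child. intros [z [Uz Rz]]. simpl. auto. }
  assert (Hlt : forall (U : X -> Prop) f x y, U y -> R y x -> olt (f y) (sub U f x)).
  { intros U f x y Uy Ry. exists (exist _ y (conj Uy Ry)). apply ole_refl. }
  assert (Hbd : forall (U : X -> Prop) f c x, (forall y, U y -> olt (f y) c) -> ole (sub U f x) c).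
  { intros U f c x H. apply ole_child. intros [z [Uz Rz]]. simpl. auto. }
  exists (fun x => nadd (sub S r x) (sub T q x)). split.
  - intros x [Hx|Hx].
    + apply nadd_lt_l; [|auto]. eapply ole_olt_trans; [apply Hle|]; auto.
    + apply nadd_lt_r; [auto|]. eapply ole_olt_trans; [apply Hle|]; auto.
  - intros x y _ [Hy|Hy] Ryx.
    + apply nadd_lt_l; [|auto]. eapply ole_olt_trans; [apply Hle|]; auto.
    + apply nadd_lt_r; [auto|]. eapply ole_olt_trans; [apply Hle|]; auto.
Qed.

(** Ranks below [c * m] are cut into [m] blocks of length [c]. Each block has R-type below [w] by
    hypothesis, and finitely many unions stay below the additively closed [w]. *)
Lemma rk_copies {X : Type} (S : X -> Prop) (R P : X -> X -> Prop) (c w : Ord) : trans R ->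
  add_closed w -> olt ozero w ->
  (forall T : X -> Prop, (forall x, T x -> S x) -> rk T P c -> exists b, olt b w /\ rk T R b) ->
  forall m (T : X -> Prop), (forall x, T x -> S x) -> rk T P (omul c (onat m)) ->
  exists b, olt b w /\ rk T R b.
Proof.
  intros HR Hw Hw0 Hc. induction m as [|m IH]; intros T HTS [rho [H1 H2]].
  { exists ozero. split; [exact Hw0|]. exists rho.
    assert (N : forall x, T x -> False).
    { intros x Tx. pose proof (proj1 (olt_omul _ _ _) (H1 x Tx)) as [[] _]. }
    split; intros x; [|intros y]; intros; destruct (N x); assumption. }
  set (d := omul c (onat m)) in *.
  assert (H1' : forall x, T x -> olt (rho x) (oadd d c)).
  { intros x Tx. eapply olt_ole_trans; [apply H1, Tx|apply omul_osucc_le]. }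
  destruct (IH (fun x => T x /\ olt (rho x) d)) as [b1 [Hb1 Hr1]].
  { intros x Hx. apply HTS, Hx. }
  { exists rho. split; [intros x Hx; apply Hx|]. intros x y Hx Hy. apply H2; [apply Hx|apply Hy]. }
  set (U := fun x => T x /\ ole d (rho x)).
  (* On the top block, the remainder after subtracting [c * m] serves as the new P-rank. *)
  assert (Hrem : forall x, exists e, U x ->
    olt e c /\ ole (rho x) (oadd d e) /\ ole (oadd d e) (rho x)).
  { intro x. destruct (classic (U x)) as [[Tx Ux]|N].
    - destruct (oadd_interval d c (rho x) Ux (H1' x Tx)) as [e He]. exists e. auto.
    - exists ozero. intro. contradiction. }
  set (eta := fun x => proj1_sig (constructive_indefinite_description _ (Hrem x))).
  assert (Heta : forall x, U x ->
    olt (eta x) c /\ ole (rho x) (oadd d (eta x)) /\ ole (oadd d (eta x)) (rho x)).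
  { intro x. unfold eta. destruct (constructive_indefinite_description _ (Hrem x)); assumption. }
  destruct (Hc U) as [b2 [Hb2 Hr2]].
  { intros x Hx. apply HTS, Hx. }
  { exists eta. split; [intros x Ux; apply Heta, Ux|].
    intros x y Ux Uy Pyx. apply oadd_lt_cancel with d.
    eapply ole_olt_trans; [apply Heta, Uy|]. eapply olt_ole_trans; [|apply Heta, Ux].
    apply H2; [apply Ux|apply Uy|exact Pyx]. }
  exists (nadd b1 b2). split; [apply Hw; assumption|].
  eapply rk_weaken; [exact (rk_union _ _ R _ _ HR Hr1 Hr2)|apply ole_refl|].
  intros x Tx. unfold U. destruct (ole_or_olt d (rho x)); auto.
Qed.

(* Below a point x, R is covered by {P-below x} and {Q-below x}; each splits into finitely
   many pieces on which one of the two exponents has dropped. *)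
Lemma rk_product {X : Type} (R P Q : X -> X -> Prop) : trans R ->
  forall (a b : Ord) (S : X -> Prop),
  (forall x y, S x -> S y -> R y x -> P y x \/ Q y x) ->
  rk S P (oexpw a) -> rk S Q (oexpw b) -> rk S R (oexpw (nadd a b)).
Proof.
  intros HR a. induction a as [Ix f IHa]. intro b. induction b as [Jx g IHb].
  intros S HS HP HQ. apply rk_below; [exact HR|]. intros x Sx.
  set (a := OSup Ix f) in *. set (b := OSup Jx g) in *.
  assert (Hw := oexpw_add_closed (nadd a b)).
  assert (Hpos := oexpw_pos (nadd a b)).
  assert (HL : exists c, olt c (oexpw (nadd a b)) /\
    rk (fun y => S y /\ R y x /\ P y x) R c).
  { destruct HP as [r [Hr1 Hr2]].
    (* Either the P-rank of [x] is zero and nothing is P-below [x], or it lies below a finite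
       multiple of a smaller power of omega, whose blocks fall under the induction hypothesis. *)
    destruct (proj1 (olt_oexpw _ _) (Hr1 x Sx)) as [H|[i [n H]]].
    - exists ozero. split; [exact Hpos|]. exists r.
      assert (N : forall y, S y /\ R y x /\ P y x -> False).
      { intros y [Sy [_ Py]]. apply (olt_ozero (r y)).
        eapply olt_ole_trans; [apply (Hr2 x y)|]; eauto. }
      split; intros y; [|intros z]; intros; destruct (N y); assumption.
    - apply (rk_copies S R P (oexpw (child a i)) _ HR Hw Hpos) with (m := n).
      + intros T HT Tp. exists (oexpw (nadd (f i) b)). split.
        * apply oexpw_lt_mono, nadd_lt_l; [exact (olt_intro a i)|apply ole_refl].
        * apply IHa; [intros; apply HS; auto|exact Tp|].
          eapply rk_weaken; [exact HQ|apply ole_refl|exact HT].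
      + intros y Hy. apply Hy.
      + exists r. split; [|intros y z Hy Hz; apply Hr2; [apply Hy|apply Hz]].
        intros y [Sy [_ Py]]. eapply olt_trans; [apply (Hr2 x y)|exact H]; auto. }
  assert (HM : exists c, olt c (oexpw (nadd a b)) /\
    rk (fun y => S y /\ R y x /\ Q y x) R c).
  { destruct HQ as [r [Hr1 Hr2]].
    destruct (proj1 (olt_oexpw _ _) (Hr1 x Sx)) as [H|[i [n H]]].
    - exists ozero. split; [exact Hpos|]. exists r.
      assert (N : forall y, S y /\ R y x /\ Q y x -> False).
      { intros y [Sy [_ Py]]. apply (olt_ozero (r y)).
        eapply olt_ole_trans; [apply (Hr2 x y)|]; eauto. }
      split; intros y; [|intros z]; intros; destruct (N y); assumption.
    - apply (rk_copies S R Q (oexpw (child b i)) _ HR Hw Hpos) with (m := n).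
      + intros T HT Tq. exists (oexpw (nadd a (g i))). split.
        * apply oexpw_lt_mono, nadd_lt_r; [apply ole_refl|exact (olt_intro b i)].
        * apply IHb; [intros; apply HS; auto| |exact Tq].
          eapply rk_weaken; [exact HP|apply ole_refl|exact HT].
      + intros y Hy. apply Hy.
      + exists r. split; [|intros y z Hy Hz; apply Hr2; [apply Hy|apply Hz]].
        intros y [Sy [_ Py]]. eapply olt_trans; [apply (Hr2 x y)|exact H]; auto. }
  destruct HL as [c [Hc HL]], HM as [d [Hd HM]].
  exists (nadd c d). split; [apply Hw; assumption|].
  eapply rk_weaken; [exact (rk_union _ _ R _ _ HR HL HM)|apply ole_refl|].
  intros y [Sy Ry]. destruct (HS x y Sx Sy Ry); auto.
Qed.

(** * Ordinal types of real functions in terms of ranks *)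

Definition desc (h : R -> R) (y x : R) : Prop := y < x /\ h y < h x.

Lemma desc_trans (h : R -> R) : trans (desc h).
Proof. unfold desc. intros x y z [H1 H2] [H3 H4]. split; lra. Qed.

(** For ordinal decreasing [h] this amounts to [ole (otype D h) a], but with ranks attached to
    points instead of bad sequences. *)
Definition ht (D : R -> Prop) (h : R -> R) (a : Ord) : Prop := rk D (desc h) a.

Lemma theight_child (D : R -> Prop) (h : R -> R) (v : list R) (H : Acc (tchild D h) v)
  (x : R) (Hx : bad D h (x :: v)) (K : Acc (tchild D h) (x :: v)) :
  olt (theight D h (x :: v) K) (theight D h v H).
Proof.
  assert (Irr : forall w (H1 H2 : Acc (tchild D h) w),
    ole (theight D h w H1) (theight D h w H2)).
  { fix IH 2. intros w [H1] [H2]. simpl. intro p. exists p. apply IH. }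
  destruct H as [H]. simpl theight. apply olt_child. exists (exist _ x Hx). apply Irr.
Qed.

(** An inaccessible point has an inaccessible point below it; choosing one repeatedly yields an
    infinite bad sequence. *)
Lemma ordinal_decreasing_acc (D : R -> Prop) (h : R -> R) :
  ordinal_decreasing D h -> forall x, Acc (restr D (desc h)) x.
Proof.
  intros H x. apply NNPP. intro N. apply H.
  set (B := {x : R | ~ Acc (restr D (desc h)) x}).
  assert (Hnext : forall b : B, exists c : B, restr D (desc h) (proj1_sig c) (proj1_sig b)).
  { intros [b Hb]. apply NNPP. intro K. apply Hb. constructor. intros c Hc.
    apply NNPP. intro Nc. apply K. exists (exist _ c Nc). exact Hc. }
  set (next := fun b => proj1_sig (constructive_indefinite_description _ (Hnext b))).
  assert (Hn : forall b, restr D (desc h) (proj1_sig (next b)) (proj1_sig b)).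
  { intro b. unfold next. destruct (constructive_indefinite_description _ _); assumption. }
  exists (fun n => proj1_sig (Nat.iter n next (exist _ x N))).
  intro n. destruct (Hn (Nat.iter n next (exist _ x N))) as [_ [HD [H1 H2]]]. auto.
Qed.

(** Whether a bad sequence can be prolonged depends only on its last entry, stored at the head; the
    rank of that entry is at most the height of the vertex. *)
Lemma ht_otype (D : R -> Prop) (h : R -> R) :
  ordinal_decreasing D h -> ht D h (otype D h).
Proof.
  intro H. assert (Hacc := ordinal_decreasing_acc D h H).
  assert (Ht : forall x v, Acc (tchild D h) (x :: v)).
  { intro x. induction (Hacc x) as [x _ IH]. intro v. constructor.
    intros w [y [-> [Dy [[Hyx Hh] [Dx _]]]]]. apply IH. repeat split; auto. }
  assert (Hnil : Acc (tchild D h) nil).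
  { constructor. intros w [y [-> _]]. apply Ht. }
  apply rk_of_rank. intros x Dx. split; [apply Hacc|].
  assert (Hle : forall x v (K : Acc (tchild D h) (x :: v)), bad D h (x :: v) ->
    ole (rank (restr D (desc h)) x) (theight D h (x :: v) K)).
  { clear x Dx. intro x. induction (Hacc x) as [x _ IH]. intros v K Hb. apply rank_le.
    intros y Hy. eapply ole_olt_trans; [apply (IH y Hy (x :: v)%list (Ht _ _))|].
    - destruct Hy as [Dy [Dx Hyx]]. split; [exact Dy|]. split; assumption.
    - apply theight_child. destruct Hy as [Dy [Dx Hyx]]. split; [exact Dy|]. split; assumption. }
  assert (Hx : bad D h (x :: nil)) by (simpl; auto).
  eapply ole_olt_trans; [apply (Hle x nil (Ht _ _) Hx)|].
  unfold otype. destruct (excluded_middle_informative _) as [K|N]; [|contradiction].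
  apply theight_child, Hx.
Qed.

Lemma otype_le (D : R -> Prop) (h : R -> R) (a : Ord) : ht D h a -> ole (otype D h) a.
Proof.
  intros [rho [H1 H2]]. unfold otype.
  destruct (excluded_middle_informative _) as [[K]|_]; [|apply ozero_le].
  assert (Hle : forall b x v (K : Acc (tchild D h) (x :: v)), rho x = b -> bad D h (x :: v) ->
    ole (theight D h (x :: v) K) (rho x)).
  { induction b as [b IH] using (well_founded_ind olt_wf). intros x v [K'] Hb Hx.
    apply ole_child. simpl. intros [y Hy]. simpl.
    assert (Hlt : olt (rho y) (rho x)).
    { destruct Hy as [Dy [Hyx [Dx _]]]. apply H2; assumption. }
    eapply ole_olt_trans; [|exact Hlt]. eapply IH; [|reflexivity|exact Hy]. congruence. }
  apply ole_child. simpl. intros [y Hy]. simpl.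
  eapply ole_olt_trans; [eapply Hle; [reflexivity|exact Hy]|]. apply H1, Hy.
Qed.

Lemma ht_ordinal_decreasing (D : R -> Prop) (h : R -> R) (a : Ord) :
  ht D h a -> ordinal_decreasing D h.
Proof.
  intros [rho [_ H]] [u Hu].
  assert (N : forall b n, rho (u n) = b -> False).
  { induction b as [b IH] using (well_founded_ind olt_wf). intros n Hn.
    apply (IH (rho (u (S n)))) with (n := S n); [|reflexivity]. rewrite <- Hn.
    destruct (Hu n) as [H1 H2]. destruct (Hu (S n)) as [H3 _]. apply H; assumption. }
  exact (N _ 0%nat eq_refl).
Qed.

(** For [y < x], either the shifted arguments decrease as well and [M] descends between them, or
    [y - s y >= x - s x], which forces [s y < s x]. *)
Lemma ht_shift (D I : R -> Prop) (M s : R -> R) (a b : Ord) :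
  ht I M (oexpw a) -> ht D s (oexpw b) -> (forall x, D x -> I (x - s x)) ->
  ht D (fun x => M (x - s x)) (oexpw (nadd a b)).
Proof.
  intros HM Hs HD.
  apply (rk_product (desc (fun x => M (x - s x)))
    (fun y x => desc M (y - s y) (x - s x)) (desc s)).
  - apply desc_trans.
  - intros x y _ _ [H1 H2]. unfold desc.
    destruct (Rlt_or_le (y - s y) (x - s x)) as [K|K]; [auto|].
    right. split; lra.
  - eapply (rk_pullback D I _ _ (fun x => x - s x)); [exact HM|apply ole_refl|exact HD|auto].
  - exact Hs.
Qed.

(** If [w] does not drop it must rise, equality being excluded by the drop of [g (- w)]; then [- w]
    drops and [g] descends. Positivity of [w] keeps the arguments of [g] negative. *)
Lemma ht_neg_comp (D : R -> Prop) (w g : R -> R) (a b : Ord) :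
  ht D w (oexpw a) -> ht negR g (oexpw b) -> (forall x, D x -> 0 < w x) ->
  ht D (fun x => g (- w x)) (oexpw (nadd a b)).
Proof.
  intros Hw Hg HD.
  apply (rk_product (desc (fun x => g (- w x))) (desc w) (fun y x => desc g (- w y) (- w x))).
  - apply desc_trans.
  - intros x y _ _ [H1 H2]. unfold desc.
    destruct (Rtotal_order (w y) (w x)) as [K|[K|K]]; [auto| |].
    + rewrite K in H2. lra.
    + right. split; lra.
  - exact Hw.
  - eapply (rk_pullback D negR _ _ (fun x => - w x)); [exact Hg|apply ole_refl| |auto].
    intros x Hx. unfold negR. specialize (HD x Hx). lra.
Qed.

Lemma rk_ext {X : Type} (S : X -> Prop) (R Q : X -> X -> Prop) (a b : Ord) :
  rk S Q a -> ole a b -> (forall x y, S x -> S y -> R y x -> Q y x) -> rk S R b.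
Proof. intros H Hab HR. eapply (rk_pullback S S R Q (fun x => x)); eauto. Qed.

Lemma ht_congr (D : R -> Prop) (h h' : R -> R) (a : Ord) :
  ht D h a -> (forall x, D x -> h' x = h x) -> ht D h' a.
Proof.
  intros H Heq. eapply rk_ext; [exact H|apply ole_refl|]. unfold desc.
  intros x y Hx Hy. rewrite (Heq x Hx), (Heq y Hy). auto.
Qed.

(** * Extending a bound from an initial segment to a longer one *)

Definition initial (I : R -> Prop) : Prop := forall x y, I x -> y <= x -> I y.

(* Well-founded induction on the rank of y for s.  All points below y where s < s y lie in an
   initial segment Z already controlled by induction; above Z one has s >= s y, so finitely
   many shifts of Z by s y reach y, and on each of them x - s x falls into the previous one. *)
Lemma ladder (M s : R -> R) (I J : R -> Prop) (A sigma B : Ord) (L : Ord -> Ord -> Prop) :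
  initial I -> initial J -> (exists x, I x) ->
  (forall x, I x -> 0 < M x) -> ht I M A ->
  (forall x, J x -> ~ I x -> 0 < s x) -> ht (fun x => J x /\ ~ I x) s sigma ->
  (forall r, exists X, L r X /\ ole A X /\
     forall r' X', olt r' r -> L r' X' -> ole X' X) ->
  (forall r X, L r X -> exists Y, L r Y /\
     forall I' J' : R -> Prop, initial I' -> initial J' ->
     (forall x, I x -> I' x) -> (forall x, I' x -> J' x) -> (forall x, J' x -> J x) ->
     (forall x, J' x -> ~ I' x -> I' (x - s x)) ->
     (forall x, I' x -> 0 < M x) -> ht I' M X ->
     (forall x, J' x -> 0 < M x) /\ ht J' M Y) ->
  ole A B -> (forall r X, olt r sigma -> L r X -> ole X B) ->
  (forall x, J x -> 0 < M x) /\ ht J M B.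
Proof.
  intros HI HJ [p Ip] HMpos HMA Hspos [rho [Hrho1 Hrho2]] Hstart Hstep HAB HLB.
  (* [L r X] means that [X] is an admissible bound for a half-line ending at a point of s-rank
     [r]. *)
  assert (Main : forall r y, J y -> ~ I y -> rho y = r ->
    exists X, L (rho y) X /\ (forall x, x <= y -> 0 < M x) /\ ht (fun x => x <= y) M X).
  { induction r as [r IH] using (well_founded_ind olt_wf). intros y Jy NIy Hr.
    set (delta := s y). assert (Hdelta : 0 < delta) by (apply Hspos; assumption).
    set (Z := fun x => I x \/ exists z, x <= z /\ z < y /\ J z /\ ~ I z /\ s z < delta).
    assert (HZ : initial Z).
    { intros x x' [Hx|[z [Hz Hz']]] Hle; [left; eauto|right].
      exists z. split; [lra|exact Hz']. }
    assert (HZI : forall z, z < y -> J z -> ~ I z -> s z < delta ->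
      exists X, L (rho z) X /\ olt (rho z) (rho y) /\
        (forall x, x <= z -> 0 < M x) /\ ht (fun x => x <= z) M X).
    { intros z Hzy Jz NIz Hsz.
      assert (Hlt : olt (rho z) (rho y)) by (apply Hrho2; [auto|auto|split; assumption]).
      destruct (IH (rho z)) with (y := z) as [X HX]; auto; [congruence|].
      exists X. tauto. }
    destruct (Hstart (rho y)) as [X0 [HX0 [HAX0 Hbelow]]].
    (* The [n]-th rung is [Z] moved right by [n * delta] and cut off at [y]; [L (rho y)] survives
       each application of [Hstep]. *)
    assert (Hn : forall n : nat, exists X, L (rho y) X /\
      (forall x, x <= y /\ Z (x - INR n * delta) -> 0 < M x) /\
      ht (fun x => x <= y /\ Z (x - INR n * delta)) M X).
    { induction n as [|n IHn].
      - exists X0. split; [exact HX0|].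
        assert (E : forall x, Z (x - INR 0 * delta) -> Z x).
        { intros x H. replace x with (x - INR 0 * delta) by (simpl; ring). exact H. }
        split.
        + intros x [_ Hx]. apply E in Hx. destruct Hx as [Hx|[z [Hxz [H1 [H2 [H3 H4]]]]]]; auto.
          destruct (HZI z) as [X HX]; auto. apply HX, Hxz.
        + eapply rk_weaken with (T := Z); [|apply ole_refl|intros x Hx; apply E, Hx].
          (* [Z] is a union of [I] and half-lines of smaller s-rank, all within the starting bound
             [X0], so gluing costs nothing. *)
          apply rk_local. intros x [Hx|[z [Hxz [H1 [H2 [H3 H4]]]]]].
          * exists I. split; [exact Hx|]. split.
            -- intros u v Iu _ [Hvu _]. apply (HI u); [exact Iu|lra].
            -- eapply rk_weaken; eauto.
          * destruct (HZI z) as [X [HX [Hlt [_ HX']]]]; auto.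
            exists (fun x => x <= z). split; [exact Hxz|]. split.
            -- intros u v Hu _ [Hvu _]. lra.
            -- eapply rk_weaken; eauto.
      - destruct IHn as [X [HX [Hpos HXM]]].
        destruct (Hstep (rho y) X HX) as [Y [HY HYstep]].
        exists Y. split; [exact HY|].
        assert (HZn : forall m, initial (fun x => x <= y /\ Z (x - INR m * delta))).
        { intros m x x' [H1 H2] Hle. split; [lra|]. eapply HZ; [exact H2|lra]. }
        assert (Hnd : 0 <= INR n * delta).
        { apply Rmult_le_pos; [apply pos_INR|lra]. }
        assert (HIn : forall x, I x -> x <= y /\ Z (x - INR n * delta)).
        { intros x Ix. split.
          - apply Rnot_lt_le. intro K. apply NIy. apply (HI x); [exact Ix|lra].
          - left. apply (HI x); [exact Ix|lra]. }
        apply (HYstep (fun x => x <= y /\ Z (x - INR n * delta))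
          (fun x => x <= y /\ Z (x - INR (S n) * delta))); auto.
        + intros x [H1 H2]. split; [exact H1|]. eapply HZ; [exact H2|].
          rewrite S_INR. lra.
        + intros x [H1 _]. apply (HJ y); assumption.
        + intros x [H1 H2] N.
          assert (NIx : ~ I x) by auto.
          assert (Jx : J x) by (apply (HJ y); assumption).
          (* With [s x < delta] the point [x] would itself witness membership in [Z], hence in the
             previous rung; [x = y] is impossible since [s y] is [delta]. *)
          assert (Hs : delta <= s x).
          { apply Rnot_lt_le. intro K. apply N. split; [exact H1|].
            apply HZ with x; [|lra]. right. exists x. split; [lra|].
            split; [|auto]. destruct H1 as [H1|H1]; [exact H1|]. subst x.
            unfold delta in K. lra. }
          split; [lra|]. eapply HZ; [exact H2|]. rewrite S_INR. lra. }
    (* Once [n * delta > y - p], shifting back by [n * delta] takes everything up to [y] below [p],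
       hence into [I]. *)
    destruct (INR_archimed delta (y - p)) as [n Hn']; [lra|].
    destruct (Hn n) as [X [HX [Hpos HXM]]].
    assert (Hall : forall x, x <= y -> x <= y /\ Z (x - INR n * delta)).
    { intros x Hx. split; [exact Hx|]. left. apply (HI p); [exact Ip|lra]. }
    exists X. split; [exact HX|]. split; [auto|].
    eapply rk_weaken; [exact HXM|apply ole_refl|exact Hall]. }
  split.
  - intros x Jx. destruct (classic (I x)) as [Ix|NIx]; [auto|].
    destruct (Main _ x Jx NIx eq_refl) as [X [_ [HX _]]]. apply HX. lra.
  - apply rk_local. intros x Jx. destruct (classic (I x)) as [Ix|NIx].
    + exists I. split; [exact Ix|]. split.
      * intros u v Iu _ [Hvu _]. apply (HI u); [exact Iu|lra].
      * eapply rk_weaken; eauto.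
    + destruct (Main _ x Jx NIx eq_refl) as [X [HX [_ HXM]]].
      exists (fun u => u <= x). split; [lra|]. split.
      * intros u v Hu _ [Hvu _]. lra.
      * eapply rk_weaken; [exact HXM| |auto]. eapply HLB; [|exact HX]. apply Hrho1. auto.
Qed.

(** Quantifying over the segments and over [s] allows reuse on each rung, with another function in
    the place of [s]. *)
Definition extends (M : R -> R) (g : nat -> R -> R) (k : nat) (A sigma B : Ord) : Prop :=
  forall (I J : R -> Prop) (s : R -> R),
  initial I -> initial J -> (exists x, I x) ->
  (forall x, I x -> 0 < M x) -> ht I M A ->
  (forall x, J x -> ~ I x -> 0 < s x) -> ht (fun x => J x /\ ~ I x) s sigma ->
  (forall x, J x -> ~ I x -> M x = Mnest M g x k (s x)) ->
  (forall x, J x -> 0 < M x) /\ ht J M B.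

(** The admissible bounds at rank [r] are [omega^l] with [l < omega^c * (r + 1)]. A rung adds only
    finitely many terms below [omega^c] to [l], so it is absorbed. *)
Lemma extends_one (M : R -> R) (g : nat -> R -> R) (A sigma c mu : Ord) :
  (forall x, x < 0 -> 0 < g 1%nat x) ->
  olt (osucc ozero) (oexpw c) -> olt mu (oexpw c) ->
  ole A (oexpw mu) -> ole sigma (oexpw mu) -> ht negR (g 1%nat) (oexpw mu) ->
  extends M g 1 A sigma (oexpw (omul (oexpw c) (osucc sigma))).
Proof.
  intros Hgpos Hc1 Hmu HA Hsig Hg I J s HI HJ HIn HMpos HMA Hspos Hs HM.
  set (W := oexpw c) in *. assert (HW : add_closed W) by apply oexpw_add_closed.
  apply ladder with (s := s) (I := I) (A := A) (sigma := sigma)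
    (L := fun r X => exists l, olt l (omul W (osucc r)) /\ X = oexpw l); auto.
  - intro r. exists (oexpw (nadd (omul W r) mu)). split; [|split].
    + eexists. split; [|reflexivity]. apply omul_absorb; [exact HW| |exact Hmu].
      eapply olt_ole_trans; [|apply omul_osucc].
      eapply ole_olt_trans; [apply oadd_le_l|]. apply oadd_lt_mono, oexpw_pos.
    + eapply ole_trans; [exact HA|]. apply oexpw_le_mono, nadd_ge_r.
    + intros r' X' Hr [l [Hl ->]]. apply oexpw_le_mono, olt_ole.
      eapply olt_ole_trans; [exact Hl|]. eapply ole_trans; [|apply nadd_ge_l].
      apply omul_le_mono; [apply ole_refl|apply ole_osucc, Hr].
  - intros r X [l [Hl ->]].
    (* One [mu] pays for [s] in the shift, the other for the outer function. *)
    set (l' := nadd (nadd l mu) mu).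
    (* The added 1 leaves room for the union of the old segment and the new part. *)
    exists (oexpw (nadd l' (osucc ozero))). split.
    + eexists. split; [|reflexivity]. repeat (apply omul_absorb; auto).
    + intros I' J' HI' HJ' HII HIJ' HJJ Hshift HpI HtI.
      set (D := fun x => J' x /\ ~ I' x).
      assert (HDs : ht D s (oexpw mu)).
      { eapply rk_weaken; [exact Hs|exact Hsig|]. intros x [H1 H2]. auto. }
      assert (HDI : forall x, D x -> I' (x - s x)) by (intros x []; auto).
      assert (HMD : forall x, D x -> M x = g 1%nat (- M (x - s x))).
      { intros x [H1 H2]. rewrite HM; auto. }
      assert (HDM : ht D M (oexpw l')).
      { eapply ht_congr; [|exact HMD].
        apply (ht_neg_comp D (fun x => M (x - s x))); [apply (ht_shift D I')|exact Hg|]; auto. }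
      split.
      * intros x Jx. destruct (classic (I' x)) as [Ix|NIx]; [auto|].
        rewrite HMD by (split; auto). apply Hgpos.
        assert (0 < M (x - s x)) by auto. lra.
      * eapply rk_weaken; [exact (rk_union _ _ _ _ _ (desc_trans M) HtI HDM)| |].
        -- apply olt_ole, oexpw_add_closed; apply oexpw_lt_mono.
           ++ eapply ole_olt_trans; [|apply nadd_lt_r; [apply ole_refl|apply olt_osucc, ole_refl]].
              eapply ole_trans; [|apply nadd_ge_l]. unfold l'.
              eapply ole_trans; [|apply nadd_ge_l]. apply nadd_ge_l.
           ++ eapply ole_olt_trans; [|apply nadd_lt_r; [apply ole_refl|apply olt_osucc, ole_refl]].
              apply nadd_ge_l.
        -- intros x Jx. unfold D. tauto.
  - eapply ole_trans; [exact HA|]. apply oexpw_le_mono, olt_ole.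
    eapply olt_ole_trans; [exact Hmu|apply le_omul_osucc].
  - intros r X Hr [l [Hl ->]]. apply oexpw_le_mono, olt_ole.
    eapply olt_ole_trans; [exact Hl|]. apply omul_le_mono; [apply ole_refl|].
    apply osucc_mono, olt_ole, Hr.
Qed.

Lemma one_lt_oexpw_osucc (a : Ord) : olt (osucc ozero) (oexpw (osucc a)).
Proof.
  eapply ole_olt_trans; [apply ole_osucc, (oexpw_pos ozero)|].
  apply oexpw_lt_mono, olt_osucc, ozero_le.
Qed.

Lemma finite_bound (G : nat -> Ord) (E : Ord) : olt ozero E -> add_closed E ->
  forall k, (forall i, (1 <= i <= k)%nat -> olt (G i) E) ->
  exists S, olt S E /\ forall i, (1 <= i <= k)%nat -> ole (G i) S.
Proof.
  intros H0 HE. induction k as [|k IH]; intro H.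
  - exists ozero. split; [exact H0|]. intros; lia.
  - destruct IH as [S [HS HS']]; [intros; apply H; lia|].
    exists (nadd S (G (Datatypes.S k))). split; [apply HE; [exact HS|apply H; lia]|].
    intros i Hi. destruct (Nat.eq_dec i (Datatypes.S k)) as [->|N]; [apply nadd_ge_r|].
    eapply ole_trans; [|apply nadd_ge_l]. apply HS'. lia.
Qed.

(** * Induction on the number of functions *)

Definition bounds (k : nat) (g : nat -> R -> R) (G : nat -> Ord) : Prop :=
  forall i, (1 <= i <= k)%nat -> (forall x, x < 0 -> 0 < g i x) /\ ht negR (g i) (G i).

(** The induction invariant: for [k = S n] functions, values of the Veblen function of level [k] are
    closed under extension. The explicit bound for [k >= 2] functions lives one level lower. *)
Definition closed_step (M : R -> R) (g : nat -> R -> R) (G : nat -> Ord) (n : nat) : Prop :=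
  forall a A sigma, (forall i, (1 <= i <= S n)%nat -> olt (G i) (veblen (S n) a)) ->
  olt A (veblen (S n) a) -> olt sigma (veblen (S n) a) ->
  exists B, olt B (veblen (S n) a) /\ extends M g (S n) A sigma B.

(** The explicit bound for one function uses only natural sums, successors, products and powers of
    omega, and [veblen 1 a] is an epsilon number. *)
Lemma closed_step_zero (M : R -> R) (g : nat -> R -> R) (G : nat -> Ord) :
  bounds 1 g G -> closed_step M g G 0.
Proof.
  intros HG a A sigma HGa HA Hsig.
  destruct (HG 1%nat) as [Hpos Hht]; [lia|].
  assert (Hcl := veblen_add_closed 1 a).
  set (mu := nadd (nadd A sigma) (G 1%nat)).
  assert (Hmu : olt mu (veblen 1 a)) by (apply Hcl; [apply Hcl|apply HGa]; auto).
  exists (oexpw (omul (oexpw (osucc mu)) (osucc sigma))). split.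
  - apply veblen_oexpw_closed. eapply ole_olt_trans; [apply omul_oexpw_le|].
    apply veblen_oexpw_closed, Hcl; apply veblen_osucc_closed; assumption.
  - apply extends_one with mu.
    + exact Hpos.
    + apply one_lt_oexpw_osucc.
    + apply (proj1 (ole_osucc _ _)), oexpw_ge.
    + eapply ole_trans; [|apply oexpw_ge]. unfold mu.
      eapply ole_trans; [|apply nadd_ge_l]. apply nadd_ge_l.
    + eapply ole_trans; [|apply oexpw_ge]. unfold mu.
      eapply ole_trans; [|apply nadd_ge_l]. apply nadd_ge_r.
    + eapply rk_weaken; [exact Hht| |auto]. eapply ole_trans; [|apply oexpw_ge]. apply nadd_ge_r.
Qed.

(** The admissible bounds at rank [r] are the ordinals below [E r]. On each rung the innermost layer
    replaces [s], and [closed_step] for one function fewer keeps the result below [E r]. *)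
Lemma extends_veblen (M : R -> R) (g : nat -> R -> R) (G : nat -> Ord) (n : nat)
  (gamma A sigma : Ord) :
  bounds (S (S n)) g G -> closed_step M g G n ->
  (forall i, (1 <= i <= S (S n))%nat -> olt (G i) (veblen (S n) gamma)) ->
  olt A (veblen (S n) gamma) -> olt sigma (veblen (S n) gamma) ->
  extends M g (S (S n)) A sigma (veblen (S n) (osucc (oadd gamma sigma))).
Proof.
  intros HG Hstep HGg HA Hsig I J s HI HJ HIn HMpos HMA Hspos Hs HM.
  set (E := fun r => veblen (S n) (osucc (oadd gamma r))).
  assert (HE : forall r, ole (veblen (S n) gamma) (E r)).
  { intro r. apply veblen_le_mono. eapply ole_trans; [apply oadd_le_l|].
    apply olt_ole, olt_osucc, ole_refl. }
  apply ladder with (s := s) (I := I) (A := A) (sigma := sigma)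
    (L := fun r X => olt X (E r)); auto.
  (* This start value is at least every [E r'] with [r' < r], because [gamma + r' + 1] is at most
     [gamma + r]. *)
  - intro r. exists (veblen (S n) (oadd gamma r)). split; [|split].
    + apply veblen_lt_mono, olt_osucc, ole_refl.
    + apply olt_ole. eapply olt_ole_trans; [exact HA|]. apply veblen_le_mono, oadd_le_l.
    + intros r' X' Hr HX. apply olt_ole. eapply olt_ole_trans; [exact HX|].
      apply veblen_le_mono, ole_osucc, oadd_lt_mono, Hr.
  - intros r X HX.
    assert (Hcl := veblen_add_closed (S n) (osucc (oadd gamma r))). fold (E r) in Hcl.
    assert (HGk := HGg (S (S n)) ltac:(lia)).
    set (mu := nadd (nadd X sigma) (G (S (S n)))).
    assert (Hmu : olt mu (E r)).
    { apply Hcl; [apply Hcl|]; auto; eapply olt_ole_trans; eauto. }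
    assert (HXmu : ole X (oexpw mu)).
    { eapply ole_trans; [|apply oexpw_ge]. unfold mu.
      eapply ole_trans; [|apply nadd_ge_l]. apply nadd_ge_l. }
    assert (Hsmu : ole sigma (oexpw mu)).
    { eapply ole_trans; [|apply oexpw_ge]. unfold mu.
      eapply ole_trans; [|apply nadd_ge_l]. apply nadd_ge_r. }
    assert (HGmu : ole (G (S (S n))) (oexpw mu)).
    { eapply ole_trans; [|apply oexpw_ge]. apply nadd_ge_r. }
    (* The exponents come from [M], from [s] and from the innermost function; [tau] bounds the type
       of the innermost layer. *)
    set (tau := oexpw (nadd (nadd mu mu) mu)).
    assert (Htau : olt tau (E r)).
    { apply veblen_oexpw_closed. fold (E r). auto. }
    destruct (Hstep (osucc (oadd gamma r)) X tau) as [Y [HY HYext]]; auto.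
    { intros i Hi. eapply olt_ole_trans; [apply HGg; lia|apply HE]. }
    exists Y. split; [exact HY|].
    intros I' J' HI' HJ' HII HIJ' HJJ Hshift HpI HtI.
    destruct (HG (S (S n))) as [Hgpos Hght]; [lia|].
    (* Unfolding [Mnest] once turns the equation for [M] into one with [S n] functions and this
       layer as starting value. *)
    apply (HYext I' J' (fun x => g (S (S n)) (- M (x - s x)))); auto.
    + destruct HIn as [x Ix]. eauto.
    + intros x Jx NIx. apply Hgpos. assert (0 < M (x - s x)) by auto. lra.
    + apply (ht_neg_comp _ (fun x => M (x - s x))).
      * apply (ht_shift _ I').
        -- eapply rk_weaken; [exact HtI|exact HXmu|auto].
        -- eapply rk_weaken; [exact Hs|exact Hsmu|]. intros x [H1 H2]. auto.
        -- intros x []; auto.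
      * eapply rk_weaken; [exact Hght|exact HGmu|auto].
      * intros x []; auto.
  - apply olt_ole. eapply olt_ole_trans; [exact HA|apply HE].
  - intros r X Hr HX. apply olt_ole. eapply olt_ole_trans; [exact HX|].
    apply veblen_le_mono, osucc_mono, oadd_le_mono; [apply ole_refl|apply olt_ole, Hr].
Qed.

(** [extends_veblen] turns closure for one function fewer into a bound given by a value of
    [veblen (S n)], and values of the next level are closed under that function. *)
Lemma closed_step_all (M : R -> R) (g : nat -> R -> R) (G : nat -> Ord) (n : nat) :
  bounds (S n) g G -> closed_step M g G n.
Proof.
  induction n as [|n IH]; intro HG; [apply closed_step_zero, HG|].
  assert (HG' : bounds (S n) g G) by (intros i Hi; apply HG; lia).
  intros a A sigma HGa HA Hsig.
  set (E := veblen (S (S n)) a) in *.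
  assert (Hcl : add_closed E) by exact (veblen_add_closed _ _).
  destruct (finite_bound G E (veblen_pos _ _) Hcl (S (S n)) HGa) as [S0 [HS0 HGS0]].
  set (mu := nadd (nadd A sigma) S0).
  assert (Hmu : olt mu E) by (apply Hcl; [apply Hcl|]; assumption).
  assert (Hlt : forall x, ole x mu -> olt x (veblen (S n) (osucc mu))).
  { intros x Hx. eapply ole_olt_trans; [exact Hx|].
    apply (proj1 (ole_osucc _ _)), veblen_ge. }
  (* [osucc mu] takes the place of [gamma]: everything up to [mu] is below
     [veblen (S n) (osucc mu)]. *)
  exists (veblen (S n) (osucc (oadd (osucc mu) sigma))). split.
  - apply veblen_closed, veblen_osucc_closed. fold E.
    eapply ole_olt_trans; [apply oadd_le_nadd|]. apply Hcl; [|exact Hsig].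
    apply veblen_osucc_closed, Hmu.
  - apply extends_veblen with G; auto.
    + intros i Hi. apply Hlt. eapply ole_trans; [apply HGS0, Hi|apply nadd_ge_r].
    + apply Hlt. unfold mu. eapply ole_trans; [|apply nadd_ge_l]. apply nadd_ge_l.
    + apply Hlt. unfold mu. eapply ole_trans; [|apply nadd_ge_l]. apply nadd_ge_r.
Qed.

(** * From the negative half-line to all reals *)

Theorem theorem2 (k : nat) (f : R -> R) (g : nat -> R -> R) (s : R -> R)
  (M : R -> R) :
  (1 <= k)%nat ->
  ordinal_decreasing negR f ->
  (forall i : nat, (1 <= i <= k)%nat -> ordinal_decreasing negR (g i)) ->
  ordinal_decreasing nonnegR s ->
  (forall x, x < 0 -> 0 < f x) ->
  (forall (i : nat) x, (1 <= i <= k)%nat -> x < 0 -> 0 < g i x) ->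
  (forall x, 0 <= x -> 0 < s x) ->
  (forall x, x < 0 -> M x = f x) ->
  (forall x, 0 <= x -> M x = Mnest M g x k (s x)) ->
  ordinal_decreasing allR M /\
  (k = 1%nat -> forall gamma : Ord,
     olt (otype negR f) (oexpw (oexpw gamma)) ->
     olt (otype nonnegR s) (oexpw (oexpw gamma)) ->
     olt (otype negR (g 1%nat)) (oexpw (oexpw gamma)) ->
     ole (otype allR M)
         (oexpw (omul (oexpw (osucc gamma)) (osucc (otype nonnegR s))))) /\
  ((2 <= k)%nat -> forall gamma : Ord,
     olt (otype negR f) (veblen (k - 1) gamma) ->
     olt (otype nonnegR s) (veblen (k - 1) gamma) ->
     (forall i : nat, (1 <= i <= k)%nat ->
        olt (otype negR (g i)) (veblen (k - 1) gamma)) ->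
     ole (otype allR M) (veblen (k - 1) (osucc (oadd gamma (otype nonnegR s))))).
Proof.
  intros Hk Hf Hg Hs Hfpos Hgpos Hspos HMf HMs.
  set (G := fun i => otype negR (g i)).
  set (A := otype negR f). set (sigma := otype nonnegR s).
  assert (HG : bounds k g G).
  { intros i Hi. split; [intros x; apply Hgpos, Hi|apply ht_otype, Hg, Hi]. }
  (* The extension goes from the negative reals, where [M] is [f], to the whole line; the recursion
     governs the complement. *)
  assert (Hext : forall B, extends M g k A sigma B -> ht allR M B).
  { intros B HB. apply (HB negR allR s); unfold initial, negR, allR; auto.
    - intros x y H1 H2. lra.
    - exists (-1). lra.
    - intros x Hx. rewrite HMf; auto.
    - apply (ht_congr negR f M); [apply ht_otype, Hf|exact HMf].
    - intros x _ N. apply Hspos. lra.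
    - eapply rk_weaken; [apply ht_otype, Hs|apply ole_refl|].
      intros x [_ N]. unfold nonnegR. lra.
    - intros x _ N. apply HMs. lra. }
  destruct k as [|n]; [lia|].
  split; [|split].
  (* Any bound at all makes [M] ordinal decreasing, so an ordinal above all the given types is used
     as parameter. *)
  - set (b := osup (fun i => osucc (G i))).
    set (mu := nadd (nadd A sigma) b).
    assert (Hlt : forall x, ole x mu -> olt x (veblen (S n) (osucc mu))).
    { intros x Hx. eapply ole_olt_trans; [exact Hx|].
      apply (proj1 (ole_osucc _ _)), veblen_ge. }
    destruct (closed_step_all M g G n HG (osucc mu) A sigma) as [B [_ HB]].
    + intros i _. apply Hlt. apply ole_trans with b; [|apply nadd_ge_r].
      eapply ole_trans; [|apply (le_osup (fun i => osucc (G i)) i)].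
      apply olt_ole, olt_osucc, ole_refl.
    + apply Hlt. unfold mu. eapply ole_trans; [|apply nadd_ge_l]. apply nadd_ge_l.
    + apply Hlt. unfold mu. eapply ole_trans; [|apply nadd_ge_l]. apply nadd_ge_r.
    + exact (ht_ordinal_decreasing _ _ _ (Hext B HB)).
  - intros Hn gamma HA Hsig HG1. injection Hn as ->.
    apply otype_le, Hext. destruct (HG 1%nat) as [Hpos Hht]; [lia|].
    (* Here [mu = omega^gamma] and [c = gamma + 1], so the hypotheses bound all types by [omega^mu]
       and [mu < omega^c]. *)
    apply extends_one with (oexpw gamma); auto using olt_ole, one_lt_oexpw_osucc.
    + apply oexpw_lt_mono, olt_osucc, ole_refl.
    + eapply rk_weaken; [exact Hht|apply olt_ole, HG1|auto].
  - intros Hn gamma HA Hsig HGg. destruct n as [|n]; [lia|].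
    replace (S (S n) - 1)%nat with (S n) in * by lia.
    apply otype_le, Hext. apply extends_veblen with G; auto.
    apply closed_step_all. intros i Hi. apply HG. lia.
Qed.
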